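(* Let $\Pi$ be a probability measure on $\mathsf{X}\times\mathsf{Y}\times\mathsf{Z}$ with conditional distributions as in the context, and let $K^*$ be the Markov transition kernel of the out-of-order block Gibbs chain $\Gamma^*$, i.e. $$K^*\big((y,z,x),(\mathrm{d}y',\mathrm{d}z',\mathrm{d}x')\big)=\Pi_{X|Z}(\mathrm{d}x'|z')\,\Pi_{Z|XY}(\mathrm{d}z'|x,y')\,\Pi_{Y|XZ}(\mathrm{d}y'|x,z).$$ Assume that the chain $\Gamma^*$ is irreducible, aperiodic and positive Harris recurrent (so that it has a unique invariant probability distribution). Define $$\Pi^*(\mathrm{d}x,\mathrm{d}y,\mathrm{d}z)=\Pi_{X|Z}(\mathrm{d}x|z)\,\Pi_{YZ}(\mathrm{d}y,\mathrm{d}z).$$ Then $$\int_{\mathsf{X}}\int_{\mathsf{Y}}\int_{\mathsf{Z}}K^*\big((y,z,x),(\mathrm{d}y',\mathrm{d}z',\mathrm{d}x')\big)\,\Pi^*(\mathrm{d}x,\mathrm{d}y,\mathrm{d}z)=\Pi^*(\mathrm{d}x',\mathrm{d}y',\mathrm{d}z').$$ Hence the invariant distribution of $\Gamma^*$ is $\Pi^*(\mathrm{d}x,\mathrm{d}y,\mathrm{d}z)$, not the target distribution $\Pi(\mathrm{d}x,\mathrm{d}y,\mathrm{d}z)$.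
   Context: $\mathsf{X},\mathsf{Y},\mathsf{Z}$ are measurable spaces with countably generated $\sigma$-algebras, and $\Pi(\mathrm{d}x,\mathrm{d}y,\mathrm{d}z)$ (the target distribution) is a joint probability distribution with support $\mathsf{X}\times\mathsf{Y}\times\mathsf{Z}$, viewed as the law of a random vector $(X,Y,Z)$. Subscripts denote marginals (e.g. $\Pi_{YZ}$ is the law of $(Y,Z)$) and conditional distributions under $\Pi$: $\Pi_{X|Z}(\mathrm{d}x|z)$, $\Pi_{Y|XZ}(\mathrm{d}y|x,z)$, $\Pi_{Z|XY}(\mathrm{d}z|x,y)$. The out-of-order block Gibbs chain $\Gamma^*=\{(Y_n^*,Z_n^*,X_n^* )\}_{n\ge 0}$ lives on $\mathsf{Y}\times\mathsf{Z}\times\mathsf{X}$. From the state $(y,z,x)$ it moves by drawing $Y^*_{n+1}\sim\Pi_{Y|XZ}(\cdot|x,z)$, with observed value $y^*$, then $Z^*_{n+1}\sim\Pi_{Z|XY}(\cdot|x,y^* )$, with observed value $z^*$, then $X^*_{n+1}\sim\Pi_{X|Z}(\cdot|z^* )$. Measures on $\mathsf{X}\times\mathsf{Y}\times\mathsf{Z}$ are identified with measures on $\mathsf{Y}\times\mathsf{Z}\times\mathsf{X}$ by permuting coordinates.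
   Formalization: ''Not the target distribution Π'' fails when X and Y are conditionally independent given Z (then Π* = Π); it is proved whenever Π ≠ Π*, together with an example satisfying all hypotheses in which Π is not invariant. *)

(* Defs.v *)
From HB Require Import structures.
From mathcomp Require Import all_boot all_order all_algebra.
From mathcomp Require Import all_classical all_reals all_analysis.
From mathcomp Require Import measurable_realfun.

Set Implicit Arguments.
Unset Strict Implicit.
Unset Printing Implicit Defensive.

Import Order.TTheory GRing.Theory Num.Theory.
Import numFieldNormedType.Exports.

Local Open Scope classical_set_scope.
Local Open Scope ring_scope.
Local Open Scope ereal_scope.

Definition countably_generated d (T : measurableType d) : Prop :=
  exists F : (set T)^nat, (measurable : set (set T)) = <<s range F >>.

(** ** Operations on probability kernels *)

Section kpullback.
Context d0 d1 d2 (S : measurableType d0) (T : measurableType d1)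
  (U : measurableType d2) (R : realType).
Variables (k : R.-pker T ~> U) (f : {mfun S >-> T}).

Definition kpullback : S -> {measure set U -> \bar R} := fun s => k (f s).

Let measurable_kpullback A :
  measurable A -> measurable_fun [set: S] (kpullback ^~ A).
Proof.
move=> mA.
exact: (measurableT_comp (measurable_kernel k _ mA) (measurable_funPT f)).
Qed.

HB.instance Definition _ := isKernel.Build _ _ _ _ R
  kpullback measurable_kpullback.

Let kpullback_prob s : kpullback s [set: U] = 1.
Proof. exact: prob_kernel. Qed.

HB.instance Definition _ := Kernel_isProbability.Build _ _ _ _ R
  kpullback kpullback_prob.

End kpullback.

Section mkproduct_probability.
Context d0 d1 d2 (T0 : measurableType d0) (T1 : measurableType d1)
  (T2 : measurableType d2) (R : realType).
Variables (k1 : R.-pker T0 ~> T1) (k2 : R.-pker (T0 * T1) ~> T2).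

Let mkproduct_prob x : mkproduct k1 k2 x [set: T1 * T2] = 1.
Proof.
rewrite /mkproduct /= /kproduct.
rewrite (eq_integral (cst 1)); last first.
  move=> y _; rewrite kernel.intker_indicE//.
  rewrite xsectionE (_ : _ @^-1` _ = setT) ?prob_kernel//.
by rewrite integral_cst// mul1e prob_kernel.
Qed.

HB.instance Definition _ := Kernel_isProbability.Build _ _ _ _ R
  (mkproduct k1 k2) mkproduct_prob.

End mkproduct_probability.

(** The probability measure [k(a, db) mu(da)] on [A * B] *)
Section joint.
Context d1 d2 (A : measurableType d1) (B : measurableType d2) (R : realType).
Variables (mu : probability A R) (k : R.-pker A ~> B).

Definition joint (E : set (A * B)) : \bar R := \int[mu]_a k a (xsection E a).

Let joint0 : joint set0 = 0.
Proof.
rewrite /joint integral0_eq// => a _.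
by rewrite xsection0 measure0.
Qed.

Let joint_ge0 E : 0 <= joint E.
Proof. by apply: integral_ge0. Qed.

Let joint_sigma_additive : semi_sigma_additive joint.
Proof.
move=> F mF tF mUF; rewrite [X in _ --> X](_ : _ =
  \int[mu]_a (\sum_(n <oo) k a (xsection (F n) a))); last first.
  apply: eq_integral => a _; rewrite xsection_bigcup.
  apply/esym/cvg_lim => //; apply: measure_semi_sigma_additive.
  - by move=> n; exact: measurable_xsection.
  - exact: trivIset_xsection.
  - by rewrite -xsection_bigcup; exact: measurable_xsection.
apply/cvg_closeP; split.
  by apply: is_cvg_nneseries => n _ _; exact: integral_ge0.
rewrite closeE// integral_nneseries// => n.
by apply: measurable_fun_xsection_finite_kernel; rewrite inE.
Qed.

HB.instance Definition _ := isMeasure.Build _ _ _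
  joint joint0 joint_ge0 joint_sigma_additive.

Let joint_setT : joint [set: A * B] = 1.
Proof.
rewrite /joint (eq_integral (cst 1)); last first.
  by move=> a _; rewrite xsectionE (_ : _ @^-1` _ = setT) ?prob_kernel.
by rewrite integral_cst// mul1e; exact: probability_setT.
Qed.

HB.instance Definition _ := Measure_isProbability.Build _ _ _
  joint joint_setT.

End joint.

(** [k] is a version of the conditional distribution of [U] given [V] *)
Definition conditional_law d d1 d2 (Omega : measurableType d)
    (A : measurableType d1) (B : measurableType d2) (R : realType)
    (P : probability Omega R) (U : {mfun Omega >-> A}) (V : {mfun Omega >-> B})
    (k : R.-pker B ~> A) : Prop :=
  forall (E : set A) (F : set B), measurable E -> measurable F ->
    P ((U @^-1` E) `&` (V @^-1` F)) = \int[distribution P V]_(v in F) k v E.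

(** ** Markov chains on a general state space *)

Section markov_chains.
Context d (T : measurableType d) (R : realType).
Variable K : R.-pker T ~> T.

Fixpoint kiter (n : nat) (x : T) (A : set T) : \bar R :=
  if n is m.+1 then \int[K x]_y kiter m y A else \d_x A.

Definition invariant_probability (mu : probability T R) : Prop :=
  forall A, measurable A -> \int[mu]_x K x A = mu A.

Definition irreducibility_measure (phi : {sigma_finite_measure set T -> \bar R})
    : Prop :=
  0 < phi [set: T] /\
  forall A, measurable A -> 0 < phi A -> forall x, exists n, 0 < kiter n.+1 x A.

Definition irreducible : Prop := exists phi, irreducibility_measure phi.

(** Every irreducible kernel has one, and any two are equivalent, so that
    "for all maximal" and "for some maximal" agree below. *)
Definition maximal_irreducibility_measure
    (psi : {sigma_finite_measure set T -> \bar R}) : Prop :=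
  irreducibility_measure psi /\
  forall phi, irreducibility_measure phi -> phi `<< psi.

Definition cyclic_decomposition (psi : {sigma_finite_measure set T -> \bar R})
    (p : nat) (D : (set T)^nat) : Prop :=
  [/\ forall i, (i < p)%N -> measurable (D i),
      trivIset `I_p D,
      forall i, (i < p)%N -> forall x, D i x -> K x (D (i.+1 %% p)%N) = 1 &
      psi (~` \bigcup_(i < p) D i) = 0].

(** The period, i.e., the largest length of a cycle, is 1. *)
Definition aperiodic : Prop :=
  forall psi, maximal_irreducibility_measure psi ->
  forall p D, cyclic_decomposition psi p D -> (p <= 1)%N.

Section process.
Context d' (Omega : measurableType d').

(** The events determined by [W 0, ..., W n] *)
Definition natural_filtration (W : nat -> Omega -> T) (n : nat)
    : set (set Omega) :=
  <<s [set E | exists i B, [/\ (i <= n)%N, measurable B & E = W i @^-1` B]] >>.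

(** [W] is, under [P], a Markov chain with kernel [K] started at [x]. *)
Definition markov_chain_from (x : T) (P : probability Omega R)
    (W : nat -> Omega -> T) : Prop :=
  [/\ forall n, measurable_fun [set: Omega] (W n),
      forall A, measurable A -> P (W 0%N @^-1` A) = \d_x A &
      forall n F A, natural_filtration W n F -> measurable A ->
        P (F `&` (W n.+1 @^-1` A)) = \int[P]_(w in F) K (W n w) A].

End process.

(** From every starting point, the chain visits every non-negligible set
    infinitely often almost surely. The law of the chain started at [x] being
    determined by [K] and [x], its realization is irrelevant. *)
Definition harris_recurrent : Prop :=
  irreducible /\
  forall psi, maximal_irreducibility_measure psi ->
  forall A, measurable A -> 0 < psi A ->
  forall x d' (Omega : measurableType d') (P : probability Omega R)
    (W : nat -> Omega -> T), markov_chain_from x P W ->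
    P (lim_sup_set (fun n => W n @^-1` A)) = 1.

Definition positive_harris_recurrent : Prop :=
  harris_recurrent /\ exists mu, invariant_probability mu.

End markov_chains.

(** ** The out-of-order block Gibbs chain *)

Section coordinates.
Context dX dY dZ (X : measurableType dX) (Y : measurableType dY)
  (Z : measurableType dZ).

Definition pr_X (w : X * Y * Z) : X := w.1.1.
Definition pr_Y (w : X * Y * Z) : Y := w.1.2.
Definition pr_Z (w : X * Y * Z) : Z := w.2.
Definition pr_XY (w : X * Y * Z) : X * Y := (pr_X w, pr_Y w).
Definition pr_XZ (w : X * Y * Z) : X * Z := (pr_X w, pr_Z w).
Definition pr_YZ (w : X * Y * Z) : Y * Z := (pr_Y w, pr_Z w).
Definition pr_YZX (w : X * Y * Z) : Y * Z * X := (pr_YZ w, pr_X w).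

Let mX : measurable_fun setT pr_X.
Proof. exact: (measurableT_comp measurable_fst measurable_fst). Qed.
HB.instance Definition _ := isMeasurableFun.Build _ _ _ _ pr_X mX.

Let mY : measurable_fun setT pr_Y.
Proof. exact: (measurableT_comp measurable_snd measurable_fst). Qed.
HB.instance Definition _ := isMeasurableFun.Build _ _ _ _ pr_Y mY.

Let mZ : measurable_fun setT pr_Z.
Proof. exact: measurable_snd. Qed.
HB.instance Definition _ := isMeasurableFun.Build _ _ _ _ pr_Z mZ.

Let mXY : measurable_fun setT pr_XY.
Proof. exact: measurable_fun_pair. Qed.
HB.instance Definition _ := isMeasurableFun.Build _ _ _ _ pr_XY mXY.

Let mXZ : measurable_fun setT pr_XZ.
Proof. exact: measurable_fun_pair. Qed.
HB.instance Definition _ := isMeasurableFun.Build _ _ _ _ pr_XZ mXZ.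

Let mYZ : measurable_fun setT pr_YZ.
Proof. exact: measurable_fun_pair. Qed.
HB.instance Definition _ := isMeasurableFun.Build _ _ _ _ pr_YZ mYZ.

Let mYZX : measurable_fun setT pr_YZX.
Proof. exact: measurable_fun_pair. Qed.
HB.instance Definition _ := isMeasurableFun.Build _ _ _ _ pr_YZX mYZX.

(** What the three successive draws depend on, from the state [(y, z, x)]:
    [(x, z)], then [(x, y')], then [z']. *)
Definition drawY_arg (s : Y * Z * X) : X * Z := (s.2, s.1.2).
Definition drawZ_arg (t : (Y * Z * X) * Y) : X * Y := (t.1.2, t.2).
Definition drawX_arg (t : (Y * Z * X) * (Y * Z)) : Z := t.2.2.

Let m_drawY_arg : measurable_fun setT drawY_arg.
Proof.
apply: measurable_fun_pair; first exact: measurable_snd.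
exact: (measurableT_comp measurable_snd measurable_fst).
Qed.
HB.instance Definition _ := isMeasurableFun.Build _ _ _ _ drawY_arg m_drawY_arg.

Let m_drawZ_arg : measurable_fun setT drawZ_arg.
Proof.
apply: measurable_fun_pair; last exact: measurable_snd.
exact: (measurableT_comp measurable_snd measurable_fst).
Qed.
HB.instance Definition _ := isMeasurableFun.Build _ _ _ _ drawZ_arg m_drawZ_arg.

Let m_drawX_arg : measurable_fun setT drawX_arg.
Proof. exact: (measurableT_comp measurable_snd measurable_snd). Qed.
HB.instance Definition _ := isMeasurableFun.Build _ _ _ _ drawX_arg m_drawX_arg.

Definition z_of_yz (p : Y * Z) : Z := p.2.

Let m_z_of_yz : measurable_fun setT z_of_yz.
Proof. exact: measurable_snd. Qed.
HB.instance Definition _ := isMeasurableFun.Build _ _ _ _ z_of_yz m_z_of_yz.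

End coordinates.

Arguments pr_X {dX dY dZ X Y Z}.
Arguments pr_Y {dX dY dZ X Y Z}.
Arguments pr_Z {dX dY dZ X Y Z}.
Arguments pr_XY {dX dY dZ X Y Z}.
Arguments pr_XZ {dX dY dZ X Y Z}.
Arguments pr_YZ {dX dY dZ X Y Z}.
Arguments pr_YZX {dX dY dZ X Y Z}.
Arguments drawY_arg {dX dY dZ X Y Z}.
Arguments drawZ_arg {dX dY dZ X Y Z}.
Arguments drawX_arg {dX dY dZ X Y Z}.
Arguments z_of_yz {dY dZ Y Z}.

Section out_of_order.
Context dX dY dZ (X : measurableType dX) (Y : measurableType dY)
  (Z : measurableType dZ) (R : realType).

(** [Kstar s (dy', dz', dx') = kX z' dx' * kZ (x, y') dz' * kY (x, z) dy'] *)
Definition Kstar (kX : R.-pker Z ~> X) (kY : R.-pker (X * Z) ~> Y)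
    (kZ : R.-pker (X * Y) ~> Z) : R.-pker (Y * Z * X) ~> (Y * Z * X)%type :=
  mkproduct (mkproduct (kpullback kY drawY_arg) (kpullback kZ drawZ_arg))
            (kpullback kX drawX_arg).

(** [Pi] as a measure on the state space of the chain *)
Definition target (Pi : probability (X * Y * Z)%type R)
    : probability (Y * Z * X)%type R :=
  distribution Pi pr_YZX.

Definition Pistar (Pi : probability (X * Y * Z)%type R) (kX : R.-pker Z ~> X)
    : probability (Y * Z * X)%type R :=
  joint (distribution Pi pr_YZ) (kpullback kX z_of_yz).

End out_of_order.

(* Main.v *)
(** Invariance of [Pistar]: started from [Pistar], the coordinates [x] and [z]
    have the law of [(X, Z)] under [Pi], so each draw completes a pair whose law
    is a marginal of [Pi]: first [(X, Y)], then [(Y, Z)], and the last draw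
    restores [Pistar].

    Uniqueness: if [m1], [m2] are invariant probabilities, the positive and
    negative parts of [m1 - m2] are again invariant. They live on complementary
    sets, but an irreducibility measure is dominated by every nonzero invariant
    measure, so both parts vanish.

    The target can fail to be invariant: let [X] be a fair coin, [Y = X] with
    probability [3/4], and [Z] constant. The event [Y = X] has mass [3/4] under
    the target and [1/2] under [Pistar], while every nonempty set is reached in
    one step with probability at least [1/8], whence irreducibility,
    aperiodicity and Harris recurrence. *)

Require Import Defs.
From HB Require Import structures.
From mathcomp Require Import all_boot all_order all_algebra.
From mathcomp Require Import all_classical all_reals all_analysis.
From mathcomp Require Import measurable_realfun.
From mathcomp Require Import ring lra.

Set Implicit Arguments.
Unset Strict Implicit.
Unset Printing Implicit Defensive.

Import Order.TTheory GRing.Theory Num.Theory.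
Import numFieldNormedType.Exports.

Local Open Scope classical_set_scope.
Local Open Scope ring_scope.
Local Open Scope ereal_scope.

(** * Integration against products of kernels *)

Lemma measureDC d (T : measurableType d) (R : realType)
    (m : {measure set T -> \bar R}) A :
  measurable A -> m A + m (~` A) = m setT.
Proof.
move=> mA; rewrite -(setUv A) measureU ?setICr//; exact: measurableC.
Qed.

Section kernel_integrals.
Context d d' (A : measurableType d) (B : measurableType d') (R : realType).

(** A measure seen as a kernel from the one-point space, so that integration formulas for
    compositions of kernels apply to it. *)
Definition kconst (mu : {finite_measure set A -> \bar R}) :
  unit -> {measure set A -> \bar R} := fun=> mu.

Section kconst.
Variable mu : {finite_measure set A -> \bar R}.

Let measurable_kconst E :
  measurable E -> measurable_fun [set: unit] (kconst mu ^~ E).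
Proof. by move=> _; exact: measurable_cst. Qed.

HB.instance Definition _ := isKernel.Build _ _ _ _ R
  (kconst mu) measurable_kconst.

Let kconst_uub : measure_fam_uub (kconst mu).
Proof.
exists (fine (mu setT) + 1)%R => _ /=.
have /fineK {1}<- : mu setT \is a fin_num by rewrite fin_num_measure.
by rewrite lte_fin ltrDl.
Qed.

HB.instance Definition _ := Kernel_isFinite.Build _ _ _ _ R
  (kconst mu) kconst_uub.

End kconst.

Lemma ge0_integral_bind (mu : {finite_measure set A -> \bar R})
    (m : {measure set B -> \bar R}) (k : R.-pker A ~> B) (f : B -> \bar R) :
  (forall E, measurable E -> m E = \int[mu]_a k a E) ->
  measurable_fun setT f -> (forall b, 0 <= f b) ->
  \int[m]_b f b = \int[mu]_a \int[k a]_b f b.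
Proof.
move=> mE mf f0.
(* The second kernel of a composition starts from [unit * A], so [k] is pulled back along the
   projection. *)
have msnd : measurable_fun setT (@snd unit A) by exact: measurable_snd.
pose H := isMeasurableFun.Build _ _ _ _ _ msnd.
pose s : {mfun _ >-> _} := HB.pack (@snd unit A) H.
have := integral_kcomp (kconst mu) (kpullback k s) tt f0 mf.
move=> /= <-; apply: eq_measure_integral => E mE' _.
by rewrite mE.
Qed.

End kernel_integrals.

(* Integrals against [mkproduct] and [joint] reduce to [integral_kcomp] through
   this kernel, which records the point it starts from. *)
Section kgraph.
Context d d1 d2 (S : measurableType d) (A : measurableType d1)
  (B : measurableType d2) (R : realType).
Variables (k : R.-pker S ~> B) (g : {mfun S >-> A}).

Let mpair s : measurable_fun setT (fun b : B => (g s, b)).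
Proof. exact: measurable_fun_pair. Qed.

Definition kgraph (s : S) : {measure set (A * B) -> \bar R}.
Proof.
refine [the measure _ _ of pushforward (k s) (fun b : B => (g s, b))].
exact: mpair.
Defined.

Lemma kgraphE s E : kgraph s E = k s (xsection E (g s)).
Proof. by rewrite xsectionE. Qed.

Let measurable_kgraph E :
  measurable E -> measurable_fun [set: S] (kgraph ^~ E).
Proof.
(* Pulling [E] back to [S * B] turns the map into one measuring sections of a fixed measurable
   set. *)
move=> mE; pose F := [set sb : S * B | E (g sb.1, sb.2)].
have mF : measurable F.
  rewrite -[F]setTI; apply: (_ : measurable_fun setT _) => //.
  apply: measurable_fun_pair => //.
  exact: measurableT_comp.
rewrite (_ : kgraph ^~ E = fun s => k s (xsection F s)); last first.
  by apply/funext => s; rewrite kgraphE !xsectionE.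
by apply: measurable_fun_xsection_finite_kernel; rewrite inE.
Qed.

HB.instance Definition _ := isKernel.Build _ _ _ _ R
  kgraph measurable_kgraph.

Let kgraph_prob s : kgraph s setT = 1.
Proof. by rewrite kgraphE xsectionE preimage_setT prob_kernel. Qed.

HB.instance Definition _ := Kernel_isProbability.Build _ _ _ _ R
  kgraph kgraph_prob.

Lemma ge0_integral_kgraph s (f : A * B -> \bar R) :
  measurable_fun setT f -> (forall ab, 0 <= f ab) ->
  \int[kgraph s]_ab f ab = \int[k s]_b f (g s, b).
Proof. by move=> mf f0; rewrite ge0_integral_pushforward. Qed.

End kgraph.

Section iterated_integrals.
Context d0 d1 d2 (S : measurableType d0) (A : measurableType d1)
  (B : measurableType d2) (R : realType).

Lemma ge0_integral_mkproduct (k1 : R.-pker S ~> A) (k2 : R.-pker (S * A) ~> B)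
    s (f : A * B -> \bar R) :
  measurable_fun setT f -> (forall ab, 0 <= f ab) ->
  \int[mkproduct k1 k2 s]_ab f ab = \int[k1 s]_a \int[k2 (s, a)]_b f (a, b).
Proof.
move=> mf f0.
have msnd : measurable_fun setT (@snd S A) by exact: measurable_snd.
pose H := isMeasurableFun.Build _ _ _ _ _ msnd.
pose g : {mfun _ >-> _} := HB.pack (@snd S A) H.
(* The graph of [k2] remembers the point drawn by [k1], so the composition is the law of the
   pair. *)
transitivity (\int[kcomp k1 (kgraph k2 g) s]_ab f ab).
  apply: eq_measure_integral => E mE _ /=.
  apply: eq_integral => a _.
  by rewrite kernel.intker_indicE// kgraphE.
rewrite integral_kcomp//; apply: eq_integral => a _.
by rewrite ge0_integral_kgraph.
Qed.

Lemma ge0_integral_joint (mu : probability A R) (k : R.-pker A ~> B)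
    (f : A * B -> \bar R) :
  measurable_fun setT f -> (forall ab, 0 <= f ab) ->
  \int[joint mu k]_ab f ab = \int[mu]_a \int[k a]_b f (a, b).
Proof.
move=> mf f0.
have mid : measurable_fun setT (@idfun A) by exact: measurable_id.
pose H := isMeasurableFun.Build _ _ _ _ _ mid.
pose g : {mfun _ >-> _} := HB.pack (@idfun A) H.
rewrite (@ge0_integral_bind _ _ _ _ _ mu _ (kgraph k g))//.
  by apply: eq_integral => a _; rewrite ge0_integral_kgraph.
by move=> E mE; apply: eq_integral => a _; rewrite kgraphE.
Qed.

End iterated_integrals.

(** Measurable rectangles are stable under intersection and generate the product sigma-algebra. *)
Lemma eq_measure_setX d1 d2 (A : measurableType d1) (B : measurableType d2)
    (R : realType) (m1 m2 : {finite_measure set (A * B)%type -> \bar R}) :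
  (forall E F, measurable E -> measurable F -> m1 (E `*` F) = m2 (E `*` F)) ->
  forall G, measurable G -> m1 G = m2 G.
Proof.
move=> m12 G mG.
pose C := [set E `*` F | E in (measurable : set (set A)) &
                         F in (measurable : set (set B))].
apply: (measure_unique C (fun=> setT)) => //.
- by rewrite measurable_prod_measurableType.
- move=> _ _ [E1 mE1 [F1 mF1 <-]] [E2 mE2 [F2 mF2 <-]].
  rewrite -setXI; exists (E1 `&` E2); first exact: measurableI.
  by exists (F1 `&` F2) => //; exact: measurableI.
- by move=> _; exists setT => //; exists setT => //; rewrite setXTT.
- by apply: bigcup_const; exists 0%N.
- by move=> _ [E mE [F mF <-]]; exact: m12.
- by move=> _; rewrite -ge0_fin_numE// fin_num_measure.
Qed.

(** * Disintegration along a conditional law *)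

Section disintegration.
Context d d1 d2 (Omega : measurableType d) (A : measurableType d1)
  (B : measurableType d2) (R : realType).
Variables (P : probability Omega R) (U : {mfun Omega >-> A})
  (V : {mfun Omega >-> B}) (k : R.-pker B ~> A).

(** The law of [(V, U)] and the measure [joint] built from the law of [V] and [k] agree on
    rectangles by [conditional_law], hence everywhere. This lets a fresh draw from [k (V w)] be
    exchanged for [U w]. *)
Lemma ge0_disintegration (f : B * A -> \bar R) :
  conditional_law P U V k -> measurable_fun setT f -> (forall x, 0 <= f x) ->
  \int[P]_w f (V w, U w) = \int[P]_w \int[k (V w)]_u f (V w, u).
Proof.
move=> kP mf f0.
have mVU : measurable_fun setT (fun w => (V w, U w)).
  exact: measurable_fun_pair.
pose H := isMeasurableFun.Build _ _ _ _ _ mVU.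
pose VU : {mfun _ >-> _} := HB.pack (fun w => (V w, U w)) H.
have mg : measurable_fun setT (fun v => \int[k v]_u f (v, u)).
  exact: measurable_kfcomp.
rewrite -(ge0_integral_distribution V mg)/=; last first.
  by move=> v; exact: integral_ge0.
rewrite -(ge0_integral_joint _ _ mf f0) -(ge0_integral_distribution VU mf f0).
apply: eq_measure_integral => G mG _; apply: eq_measure_setX => // F E mF mE.
rewrite [LHS](_ : _ = P (U @^-1` E `&` V @^-1` F)); last first.
  by congr (P _); apply/seteqP; split => w /= [].
rewrite kP// integral_mkcond [RHS](_ : _ = \int[distribution P V]_v
  k v (xsection (F `*` E) v))//; apply: eq_integral => v _.
rewrite patchE; case: ifPn => vF; first by rewrite in_xsectionX.
by rewrite notin_xsectionX// measure0.
Qed.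

End disintegration.

(** * Invariance of the out-of-order distribution *)

Section out_of_order_invariance.
Context dX dY dZ (X : measurableType dX) (Y : measurableType dY)
  (Z : measurableType dZ) (R : realType).
Variables (Pi : probability (X * Y * Z)%type R) (kX : R.-pker Z ~> X)
  (kY : R.-pker (X * Z) ~> Y) (kZ : R.-pker (X * Y) ~> Z).

Lemma KstarE s E : measurable E ->
  Kstar kX kY kZ s E = \int[kY (s.2, s.1.2)]_y \int[kZ (s.2, y)]_z
    kX z (xsection E (y, z)).
Proof.
move=> mE.
transitivity (\int[mkproduct (kpullback kY drawY_arg)
    (kpullback kZ drawZ_arg) s]_yz kX yz.2 (xsection E yz)).
  by apply: eq_integral => yz _; rewrite kernel.intker_indicE.
rewrite ge0_integral_mkproduct//.
have := @measurable_fun_xsection_finite_kernel _ _ _ _ _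
  (kpullback kX z_of_yz) E.
by apply; rewrite inE.
Qed.

Hypotheses (kXP : conditional_law Pi pr_X pr_Z kX)
  (kYP : conditional_law Pi pr_Y pr_XZ kY)
  (kZP : conditional_law Pi pr_Z pr_XY kZ).

Lemma Pistar_invariant :
  invariant_probability (Kstar kX kY kZ) (Pistar Pi kX).
Proof.
move=> E mE.
(* [g], [h] and [Phi] are the probabilities of ending in [E] when, respectively, only the last draw,
   the last two draws and all three draws remain. *)
pose g (yz : Y * Z) := kX yz.2 (xsection E yz).
have mg : measurable_fun setT g.
  have := @measurable_fun_xsection_finite_kernel _ _ _ _ _
    (kpullback kX z_of_yz) E.
  by apply; rewrite inE.
have g0 yz : 0 <= g yz by [].
pose h (xy : X * Y) := \int[kZ xy]_z g (xy.2, z).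
have h0 xy : 0 <= h xy by exact: integral_ge0.
have mh : measurable_fun setT h.
  apply: (@measurable_kfcomp _ _ (X * Y)%type Z R kZ
    (fun xyz : X * Y * Z => g (xyz.1.2, xyz.2))) => //.
  apply: measurableT_comp => //.
  exact: (measurable_funPT pr_YZ).
pose Phi (xz : X * Z) := \int[kY xz]_y h (xz.1, y).
have Phi0 xz : 0 <= Phi xz by exact: integral_ge0.
have mhp : measurable_fun setT (fun xzy : X * Z * Y => h (xzy.1.1, xzy.2)).
  apply: measurableT_comp => //; apply: measurable_fun_pair => //.
  exact: measurableT_comp.
have mPhi : measurable_fun setT Phi.
  exact: (@measurable_kfcomp _ _ (X * Z)%type Y R kY
    (fun xzy : X * Z * Y => h (xzy.1.1, xzy.2))).
have KE s : Kstar kX kY kZ s E = Phi (s.2, s.1.2) by rewrite KstarE.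
under eq_integral do rewrite KE.
rewrite ge0_integral_joint//; last first.
  apply: measurableT_comp => //.
  exact: (measurable_funPT drawY_arg).
rewrite ge0_integral_distribution; last 2 first.
- apply: (@measurable_kfcomp _ _ (Y * Z)%type X R (kpullback kX z_of_yz)
    (fun yzx : Y * Z * X => Phi (yzx.2, yzx.1.2))) => //.
  apply: measurableT_comp => //.
  exact: (measurable_funPT drawY_arg).
- by move=> yz; exact: integral_ge0.
(* Three disintegrations follow: the draws of [x], [y], [z] are replaced in turn by the coordinates
   of [w] under [Pi]. *)
rewrite /= [LHS](_ : _ = \int[Pi]_w \int[kX (pr_Z w)]_x Phi (x, pr_Z w))//.
rewrite -(@ge0_disintegration _ _ _ _ _ _ _ Pi pr_X pr_Z kX
  (fun zx => Phi (zx.2, zx.1)))//; last first.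
  apply: measurableT_comp => //; exact: measurable_fun_pair.
rewrite /= [LHS](_ : _ = \int[Pi]_w \int[kY (pr_XZ w)]_y h ((pr_XZ w).1, y))//.
rewrite -(@ge0_disintegration _ _ _ _ _ _ _ Pi pr_Y pr_XZ kY
  (fun xzy => h (xzy.1.1, xzy.2)))//.
rewrite /= [LHS](_ : _ = \int[Pi]_w \int[kZ (pr_XY w)]_z g ((pr_XY w).2, z))//.
rewrite -(@ge0_disintegration _ _ _ _ _ _ _ Pi pr_Z pr_XY kZ
  (fun xyz => g (xyz.1.2, xyz.2)))//; last first.
  apply: measurableT_comp => //.
  exact: (measurable_funPT pr_YZ).
(* What is left is the mean of [g] under the law of [(Y, Z)], which is [Pistar] of [E] by
   definition. *)
transitivity (\int[distribution Pi pr_YZ]_yz g yz); last by [].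
by rewrite ge0_integral_distribution.
Qed.

End out_of_order_invariance.

(** * Uniqueness of the invariant probability *)

Section jordan.
Context d (T : measurableType d) (R : realType).

(** [n1] and [n2] are the positive and negative parts of [m1 - m2], and [P] is a positive set of a
    Hahn decomposition. Writing the balance as sums avoids subtraction of extended reals. *)
Lemma jordan_difference (m1 m2 : {finite_measure set T -> \bar R}) :
  exists (P : set T) (n1 n2 : {finite_measure set T -> \bar R}),
  [/\ measurable P,
      forall A, measurable A -> m1 A + n2 A = m2 A + n1 A,
      forall A, measurable A -> n1 A = n1 (A `&` P) &
      forall A, measurable A -> n2 A = n2 (A `&` ~` P)].
Proof.
pose nu := cadd (charge_of_finite_measure m1)
  (copp (charge_of_finite_measure m2)).
have [P [N nuPN]] := Hahn_decomposition nu.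
have [[mP _] [mN _] PN PN0] := nuPN.
have NE : N = ~` P.
  apply/seteqP; split => [x Nx Px|x]; last first.
    by move=> nPx; have : (P `|` N) x; [rewrite PN|case].
  by have : (P `&` N) x by []; rewrite PN0.
exists P, (jordan_pos nuPN), (jordan_neg nuPN); split => // A mA.
- pose jp : {finite_measure set T -> \bar R} := jordan_pos nuPN.
  pose jn : {finite_measure set T -> \bar R} := jordan_neg nuPN.
  have mE : m1 A - m2 A = jp A - jn A.
    have csE : cscale (-1) (jordan_neg nuPN) A = - jn A.
      by rewrite /cscale EFinN mulN1e.
    transitivity (jp A + cscale (-1) (jordan_neg nuPN) A); last by rewrite csE.
    exact: (jordan_decomp nuPN mA).
  have fin (m : {finite_measure set T -> \bar R}) : m A \is a fin_num.
    by rewrite fin_num_measure.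
  rewrite -[LHS]/(m1 A + jn A) -[RHS]/(m2 A + jp A).
  move: mE (fin m1) (fin m2) (fin jp) (fin jn).
  move: (m1 A) (m2 A) (jp A) (jn A).
  move=> [a| |] [b| |] [p| |] [n| |]// + _ _ _ _.
  rewrite -!EFinN -!EFinD => -[/eqP]; rewrite subr_eq => /eqP ->.
  by congr (_%:E); ring.
(* The positive part is the restriction of [nu] to [P], with default value 0 off the measurable
   sets. *)
- have jE B : measurable B -> jordan_pos nuPN B = nu (B `&` P).
    move=> mB.
    transitivity (if B \in measurable then nu (B `&` P) else 0) => //.
    by rewrite mem_set.
  apply: (etrans (jE A mA)); apply/esym; apply: (etrans (jE _ _)).
    exact: measurableI.
  by rewrite -setIA setIid.
- have jE B : measurable B -> jordan_neg nuPN B = - nu (B `&` N).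
    move=> mB.
    transitivity ((-1)%:E * if B \in measurable then nu (B `&` N) else 0) => //.
    by rewrite mem_set// EFinN mulN1e.
  rewrite -NE; apply: (etrans (jE A mA)); apply/esym; apply: (etrans (jE _ _)).
    exact: measurableI.
  by rewrite -setIA setIid.
Qed.

End jordan.

(** * Invariant measures of an irreducible kernel *)

Section invariant_uniqueness.
Context d (T : measurableType d) (R : realType).
Variable K : R.-pker T ~> T.

(** Stated for measures of any mass, since Jordan parts need not be probabilities. *)
Definition invariant_measure (m : {measure set T -> \bar R}) :=
  forall A, measurable A -> \int[m]_x K x A = m A.

(* On subsets of [P] the hypotheses give [n1 <= n1 K], hence everywhere; the two
   sides have the same finite total mass, so they agree. *)
Lemma jordan_invariant (m1 m2 n1 n2 : {finite_measure set T -> \bar R})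
    (P : set T) :
  measurable P ->
  (forall A, measurable A -> m1 A + n2 A = m2 A + n1 A) ->
  (forall A, measurable A -> n1 A = n1 (A `&` P)) ->
  (forall A, measurable A -> n2 A = n2 (A `&` ~` P)) ->
  invariant_measure m1 -> invariant_measure m2 -> invariant_measure n1.
Proof.
move=> mP mn nP nN im1 im2.
pose J (n : {finite_measure set T -> \bar R}) A := \int[n]_x K x A.
have Jfin n A : measurable A -> J n A \is a fin_num.
  move=> mA; rewrite ge0_fin_numE; last exact: integral_ge0.
  apply: (@le_lt_trans _ _ (\int[n]_x 1)).
    apply: ge0_le_integral => //; first exact: measurable_kernel.
    move=> x _; rewrite -(prob_kernel (s := K) x).
    by apply: le_measure; rewrite ?inE.
  by rewrite integral_cst// mul1e -ge0_fin_numE// fin_num_measure.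
have mnJ A : measurable A -> m1 A + J n2 A = m2 A + J n1 A.
  move=> mA; rewrite -(im1 A mA) -(im2 A mA) /J.
  rewrite -!ge0_integral_measure_add//; try exact: measurable_kernel.
  apply: eq_measure_integral => B mB _.
  rewrite [LHS](measure_addE m1 n2) [RHS](measure_addE m2 n1); exact: mn.
have leJ A : measurable A -> n1 A <= J n1 A.
  move=> mA.
  have mAP : measurable (A `&` P) by exact: measurableI.
  apply: (@le_trans _ _ (J n1 (A `&` P))).
    (* On subsets of [P] the measure [n2] vanishes, so subtracting the two balances gives
       [J n1 = n1 + J n2] there. *)
    have := mnJ _ mAP; have := mn _ mAP.
    rewrite (nN _ mAP) -setIA setICr setI0 measure0 adde0 -nP//.
    have : 0 <= J n2 (A `&` P) by exact: integral_ge0.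
    have := Jfin n2 _ mAP; have := Jfin n1 _ mAP.
    have : m1 (A `&` P) \is a fin_num by rewrite fin_num_measure.
    have : m2 (A `&` P) \is a fin_num by rewrite fin_num_measure.
    have : n1 A \is a fin_num by rewrite fin_num_measure.
    move: (J n2 _) (J n1 _) (m1 _) (m2 _) (n1 _).
    move=> [j2| |] [j1| |] [a| |] [b| |] [c| |]// _ _ _ _ _.
    rewrite !lee_fin -!EFinD => j20 [->] [e].
    lra.
  apply: ge0_le_integral => //; try exact: measurable_kernel.
  by move=> x _; apply: le_measure; rewrite ?inE.
have mnT := mn _ measurableT; have mnJT := mnJ _ measurableT.
have JT n : J n setT = n setT.
  rewrite /J; under eq_integral do rewrite prob_kernel.
  by rewrite integral_cst// mul1e.
move=> A mA; suff : J n1 A = n1 A by [].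
have JC : J n1 A + J n1 (~` A) = J n1 setT.
  rewrite /J -ge0_integralD//; try exact: measurable_kernel; last first.
    by apply: measurable_kernel; exact: measurableC.
  by apply: eq_integral => x _; rewrite measureDC.
have nC : n1 A + n1 (~` A) = n1 setT by exact: measureDC.
have mCA := measurableC mA.
have := leJ _ mA; have := leJ _ mCA; move: JC nC; rewrite JT => <-.
have := Jfin n1 _ mA; have := Jfin n1 _ mCA.
have : n1 A \is a fin_num by rewrite fin_num_measure.
have : n1 (~` A) \is a fin_num by rewrite fin_num_measure.
move: (J n1 A) (J n1 (~` A)) (n1 A) (n1 (~` A)).
move=> [j2| |] [j1| |] [a| |] [b| |]// _ _ _ _.
rewrite -!EFinD !lee_fin => -[e] h1 h2; congr (_%:E).
by apply/eqP; rewrite eq_le; apply/andP; split; lra.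
Qed.

Lemma kiter_ge0 n x A : 0 <= kiter K n x A.
Proof. by elim: n x => [|n IH] x //=; apply: integral_ge0. Qed.

Lemma measurable_kiter n A :
  measurable A -> measurable_fun setT (kiter K n ^~ A).
Proof.
move=> mA; elim: n => [|n IH] /=.
  apply/measurable_EFinP; exact: measurable_indic.
apply: measurable_fun_integral_kernel => //.
- by move=> U mU; exact: measurable_kernel.
- by move=> x; exact: kiter_ge0.
Qed.

Lemma integral_kiter_invariant (m : {finite_measure set T -> \bar R}) n A :
  invariant_measure m -> measurable A -> \int[m]_x kiter K n x A = m A.
Proof.
move=> im mA; elim: n => [|n IH] /=.
  by rewrite /dirac integral_indic// setIT.
apply: etrans IH; apply/esym; apply: ge0_integral_bind.
- by move=> E mE; rewrite im.
- exact: measurable_kiter.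
- by move=> x; exact: kiter_ge0.
Qed.

(** If [m A = 0], each iterate gives [A] probability 0 from [m]-almost every point, hence all
    iterates do at once. Irreducibility excludes every such point, so [m] would be zero. *)
Lemma irreducibility_measure_dominates
    (phi : {sigma_finite_measure set T -> \bar R})
    (m : {finite_measure set T -> \bar R}) A :
  irreducibility_measure K phi -> invariant_measure m -> m setT != 0 ->
  measurable A -> 0 < phi A -> m A != 0.
Proof.
move=> [_ irr] im mT mA phiA; apply/eqP => mA0.
have ae0 n : {ae m, forall x, setT x -> kiter K n.+1 x A = 0}.
  have mk := measurable_kiter n.+1 mA.
  apply/(ae_eq_integral_abs m measurableT mk).
  under eq_integral do rewrite gee0_abs ?kiter_ge0//.
  by rewrite integral_kiter_invariant.
have /negligibleP : m.-negligible [set: T].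
  apply: negligibleS (ae_foralln ae0) => x _ kx0.
  have [n] := irr A mA phiA x.
  by rewrite (kx0 n Logic.I) ltxx.
by move=> /(_ measurableT)/eqP; rewrite (negbTE mT).
Qed.

Lemma irreducible_invariant_unique (mu1 mu2 : probability T R) :
  irreducible K -> invariant_probability K mu1 ->
  invariant_probability K mu2 -> forall A, measurable A -> mu1 A = mu2 A.
Proof.
move=> [phi irr] i1 i2 A mA.
have [P [n1 [n2 [mP mn nP nN]]]] := jordan_difference mu1 mu2.
have mCP := measurableC mP.
have invn1 := jordan_invariant mP mn nP nN i1 i2.
have invn2 : invariant_measure n2.
  apply: (@jordan_invariant mu2 mu1 n2 n1 (~` P)) => // B mB.
    by rewrite mn.
  by rewrite setCK nP.
have nT : n1 setT = n2 setT.
  have pT (mu : probability T R) :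
      (mu : {finite_measure set T -> \bar R}) setT = 1.
    exact: probability_setT.
  have := mn _ measurableT; rewrite !pT.
  have : n1 setT \is a fin_num by rewrite fin_num_measure.
  have : n2 setT \is a fin_num by rewrite fin_num_measure.
  move: (n1 setT) (n2 setT) => [a| |] [b| |]// _ _.
  by rewrite -!EFinD => -[/addrI ->].
have [n10|n10] := eqVneq (n1 setT) 0.
  have z (n : {finite_measure set T -> \bar R}) : n setT = 0 -> n A = 0.
    move=> n0; apply/eqP; rewrite -measure_le0 -n0.
    by apply: le_measure; rewrite ?inE.
  have := mn _ mA; rewrite (z n1 n10) (z n2); last by rewrite -nT.
  by rewrite !adde0.
have n20 : n2 setT != 0 by rewrite -nT.
have dom := irreducibility_measure_dominates irr.
have phiT : phi P + phi (~` P) = phi setT by exact: measureDC.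
exfalso; have [phi0 _] := irr.
(* Both parts are now nonzero and invariant, hence charge every set charged by [phi]; but [n2]
   misses [P] and [n1] misses its complement. *)
have : 0 < phi P \/ 0 < phi (~` P).
  have [|phiP] := ltP 0 (phi P); first by left.
  have {}phiP : phi P = 0 by apply/eqP; rewrite -measure_le0.
  by right; move: phi0; rewrite -phiT phiP add0e.
case => [phiP|phiP].
- have := dom n2 P invn2 n20 mP phiP.
  by rewrite nN// setICr measure0 eqxx.
- have := dom n1 _ invn1 n10 mCP phiP.
  by rewrite nP// setICl measure0 eqxx.
Qed.

End invariant_uniqueness.

(** * Uniformly minorized kernels *)

Section doeblin.
Context d (T : measurableType d) (R : realType).
Variables (K : R.-pker T ~> T) (e : R).
Hypotheses (e_gt0 : (0 < e)%R)
  (Ke : forall x A, measurable A -> A !=set0 -> e%:E <= K x A).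

Lemma kiter1 x A : measurable A -> kiter K 1 x A = K x A.
Proof. by move=> mA; rewrite /= /dirac integral_indic// setIT. Qed.

(** A set charged by the Dirac mass at [x0] contains [x0], hence is nonempty and reached in one
    step. *)
Lemma doeblin_irreducible (x0 : T) : irreducible K.
Proof.
exists (\d_x0 : {sigma_finite_measure set T -> \bar R}); split.
  by rewrite [ltRHS](_ : _ = 1)//; exact: diracT.
move=> A mA A0 x; exists 0%N; rewrite kiter1//.
apply: lt_le_trans (Ke _ mA _); first by rewrite lte_fin.
exists x0; apply: contrapT => nA.
by move: A0; rewrite [ltRHS](_ : _ = 0) ?ltxx//; rewrite [LHS]diracE memNset.
Qed.

(** Some class of a cycle is nonempty. If [p > 1], the next class is disjoint from it and receives
    all the mass, so the class cannot be reached from itself in one step, against [Ke]. *)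
Lemma doeblin_aperiodic : aperiodic K.
Proof.
move=> psi [[psi0 _] _] p D [mD tD KD psiD]; rewrite leqNgt; apply/negP => p1.
have p0 : (0 < p)%N by exact: ltn_trans p1.
have [i ip [x Dix]] : exists2 i, (i < p)%N & D i !=set0.
  apply: contrapT => /forall2NP noD.
  have U0 : \bigcup_(i < p) D i = set0.
    rewrite -subset0 => x [i /= ip Dix].
    by have [/negP|] := noD i; [rewrite ip|apply; exists x].
  by move: psiD psi0; rewrite U0 setC0 => ->; rewrite ltxx.
have jp : (i.+1 %% p < p)%N by rewrite ltn_mod.
have ij : i != (i.+1 %% p)%N.
  apply/eqP => /esym ij.
  (* Cancelling [i] would leave 1 congruent to 0 modulo [p > 1]. *)
  have : (i + 1 == i + 0 %[mod p])%N by rewrite addn1 addn0 ij modn_small.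
  by rewrite eqn_modDl mod0n modn_small.
have Dij : D i `<=` ~` D (i.+1 %% p)%N.
  move=> y Diy Djy.
  have := tD i _ ip jp; move/(_ _)/eqP; rewrite (negbTE ij) => F.
  by have := F (ex_intro _ y (conj Diy Djy)).
have KC : K x (~` D (i.+1 %% p)%N) = 0.
  have := KD i ip x Dix => K1.
  have mDj := mD _ jp.
  have : K x (D (i.+1 %% p)%N) + K x (~` D (i.+1 %% p)%N) = 1.
    by rewrite measureDC// prob_kernel.
  rewrite K1 => /eqP.
  move: (K x (~` _)) => [r| |]//=; rewrite -EFinD eqe => /eqP r1.
  by congr (_%:E); apply: (@addrI _ 1%R); rewrite r1 addr0.
have := Ke x (mD _ ip) (ex_intro _ _ Dix).
apply/negP; rewrite -ltNge.
apply: (@le_lt_trans _ _ 0); last by rewrite lte_fin.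
rewrite -KC; apply: le_measure => //; rewrite inE; first exact: mD.
by apply: measurableC; exact: mD.
Qed.

(** * Recurrence under uniform minorization *)

Lemma natural_filtration_avoid d' (Omega : measurableType d')
    (W : nat -> Omega -> T) n m A : measurable A ->
  natural_filtration W (n + m)
    (\bigcap_(j in [set j | (n < j <= n + m)%N]) (W j @^-1` (~` A))).
Proof.
move=> mA; rewrite /natural_filtration.
set G := [set E | _].
apply: (@bigcap_measurableType _ (g_sigma_algebraType G)) => j /= /andP[nj jm].
apply: sub_sigma_algebra; exists j, (~` A); split => //.
exact: measurableC.
Qed.

(** Having avoided [A] up to time [n + m] is an event of the past, so by the Markov property the
    next step costs a factor of at most [1 - e]. *)
Lemma doeblin_avoid x d' (Omega : measurableType d') (P : probability Omega R)
    (W : nat -> Omega -> T) A n m :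
  markov_chain_from K x P W -> measurable A -> A !=set0 -> (e <= 1)%R ->
  P (\bigcap_(j in [set j | (n < j <= n + m)%N]) (W j @^-1` (~` A)))
    <= ((1 - e) ^+ m)%:E.
Proof.
move=> [mW _ WK] mA A0 e1; have mCA := measurableC mA.
elim: m => [|m IH].
  rewrite expr0; apply: probability_le1.
  apply: bigcap_measurableType => j _; rewrite -[X in measurable X]setTI.
  exact: mW.
set F := \bigcap_(j in _) _ in IH.
rewrite [X in P X](_ : _ = F `&` W (n + m).+1 @^-1` (~` A)); last first.
  apply/seteqP; split => w.
    move=> Fw; split.
      by move=> j /andP[nj jm]; apply: Fw; rewrite /= nj addnS (leq_trans jm).
    by apply: Fw; rewrite /= addnS ltnS leq_addr leqnn.
  move=> [Fw Ww] j /= /andP[nj]; rewrite addnS leq_eqVlt => /orP[/eqP ->//|jm].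
  by apply: Fw; rewrite /= nj -ltnS.
have nF : natural_filtration W (n + m) F by exact: natural_filtration_avoid.
have mF : measurable F.
  apply: bigcap_measurableType => j _; rewrite -[X in measurable X]setTI.
  exact: mW.
rewrite (WK _ _ _ nF mCA).
apply: (@le_trans _ _ (\int[P]_(w in F) (1 - e)%:E)).
  apply: ge0_le_integral => //.
    apply: measurable_funTS.
    exact: measurableT_comp (measurable_kernel K _ mCA) (mW _).
  move=> w _; have := Ke (W (n + m)%N w) mA A0.
  have : K (W (n + m)%N w) A + K (W (n + m)%N w) (~` A) = 1.
    by rewrite measureDC// prob_kernel.
  move: (K _ A) (K _ (~` A)) => [a| |] [b| |]//.
  rewrite -EFinD !lee_fin => -[ab] ea; lra.
rewrite integral_cst// exprS EFinM; apply: lee_pmul => //.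
by rewrite lee_fin subr_ge0.
Qed.

Lemma doeblin_visits x d' (Omega : measurableType d') (P : probability Omega R)
    (W : nat -> Omega -> T) A :
  markov_chain_from K x P W -> measurable A -> A !=set0 ->
  P (lim_sup_set (fun n => W n @^-1` A)) = 1.
Proof.
move=> chain mA A0; have [mW _ _] := chain.
have mWA B j : measurable B -> measurable (W j @^-1` B).
  by move=> mB; rewrite -[X in measurable X]setTI; exact: mW.
have e1 : (e <= 1)%R.
  rewrite -lee_fin -(prob_kernel (s := K) x).
  by apply: (le_trans (Ke x mA A0)); apply: le_measure; rewrite ?inE.
(* Avoiding [A] at all times after [n] is null, its probability being at most [(1 - e) ^+ m] for
   every [m]. *)
pose N n := \bigcap_(j in [set j | (n < j)%N]) (W j @^-1` (~` A)).
have mN n : measurable (N n).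
  by apply: bigcap_measurableType => j _; apply: mWA; exact: measurableC.
have N0 n : P (N n) = 0.
  apply/eqP; rewrite -measure_le0.
  have le m : P (N n) <= ((1 - e) ^+ m)%:E.
    apply: le_trans (doeblin_avoid n m chain mA A0 e1).
    apply: le_measure; rewrite ?inE//.
      by apply: bigcap_measurableType => j _; apply: mWA; exact: measurableC.
    by move=> w Nw j /= /andP[nj _]; exact: Nw.
  have c0 : ((1 - e) ^+ m)%:E @[m --> \oo] --> 0.
    apply: cvg_EFin; first exact: nearW.
    by apply: cvg_expr; rewrite ger0_norm ?subr_ge0// ltrBlDr ltrDl.
  by apply: (cvge_to_ge c0); exists 0%N => // m _; exact: le.
set L := lim_sup_set _.
have mL : measurable L.
  apply: bigcap_measurableType => k _.
  by apply: bigcup_measurable => j _; exact: mWA.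
(* [lim_sup_set] looks at times [j >= n] and [N n] at times [j > n]; the inclusion is enough. *)
have LC : ~` L `<=` \bigcup_n N n.
  move=> w; rewrite /L /lim_sup_set setC_bigcap => -[n _ nw].
  exists n => // j /= nj Ajw; apply: nw; exists j => //=; exact: ltnW.
have PLC : P (~` L) = 0.
  apply/eqP; rewrite -measure_le0.
  have U0 : P (\bigcup_n N n) = 0.
    have /negligibleP : P.-negligible (\bigcup_n N n).
      apply: negligible_bigcup => n.
      by apply/negligibleP; [exact: mN|exact: N0].
    by apply; apply: bigcupT_measurable.
  rewrite -U0; apply: le_measure => //; rewrite inE.
    exact: measurableC.
  exact: bigcupT_measurable.
by rewrite -[L]setCK probability_setC ?PLC ?sube0//; exact: measurableC.
Qed.

Lemma doeblin_harris (x0 : T) : harris_recurrent K.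
Proof.
split; first exact: doeblin_irreducible.
move=> psi _ A mA psiA x d' Omega P W chain; apply: doeblin_visits chain mA _.
by apply/set0P/eqP => A0; rewrite A0 measure0 ltxx in psiA.
Qed.

End doeblin.

(** * A target that is not invariant *)

Section discrete_products.

Lemma measurable_bool_prod d (T : measurableType d) (C : set (bool * T)) :
  (forall B : set T, measurable B) -> measurable C.
Proof.
move=> mT; rewrite (_ : C = [set true] `*` xsection C true `|`
    [set false] `*` xsection C false); last first.
  apply/seteqP; split => [[[] t] Ct|[b t] [|] [/= ->]].
  - by left; split => //; rewrite /xsection /= inE.
  - by right; split => //; rewrite /xsection /= inE.
  - by rewrite /xsection /= inE.
  - by rewrite /xsection /= inE.
by apply: measurableU; apply: measurableX.
Qed.

Lemma measurable_prod_unit d (S : measurableType d) (C : set (S * unit)) :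
  (forall B : set S, measurable B) -> measurable C.
Proof.
move=> mS; rewrite (_ : C = [set s | C (s, tt)] `*` setT).
  exact: measurableX.
by apply/seteqP; split => [[s []] Cs|[s []] []].
Qed.

(** The fibres of [c] are empty or singletons, and every set is a countable union of them. *)
Lemma countably_generated_countType d (T : measurableType d) (c : T -> nat) :
  injective c -> (forall B : set T, measurable B) -> countably_generated T.
Proof.
move=> cI mT; exists (fun n => c @^-1` [set n]).
apply/seteqP; split => [A _|A _]; last exact: mT.
pose G : set (set T) := range (fun n => c @^-1` [set n]).
rewrite (_ : A = \bigcup_(n in c @` A) (c @^-1` [set n])); last first.
  apply/seteqP; split => [x Ax|x [n [y Ay <-]] /= /cI ->//].
  by exists (c x) => //; exists x.
apply: (@bigcup_measurable _ (g_sigma_algebraType G)) => n _.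
by apply: sub_sigma_algebra; exists n.
Qed.

End discrete_products.

(** Of the two nonnegative terms of the integral, only the one at [b] is kept; its weight is at
    least [q]. *)
Lemma ge_integral_bernoulli (R : realType) (p q : R) (f : bool -> \bar R) b :
  (0 <= q <= p)%R -> (q <= 1 - p)%R -> (forall x, 0 <= f x) ->
  q%:E * f b <= \int[bernoulli_prob p]_x f x.
Proof.
move=> /andP[q0 qp] qp1 f0; rewrite integral_bernoulli_prob//; last first.
  by apply/andP; split; lra.
rewrite [leRHS](_ : _ = p%:E * f true + (1 - p)%:E * f false)//.
have p0 : 0 <= p%:E by rewrite lee_fin; lra.
have p10 : 0 <= (1 - p)%:E by rewrite lee_fin; lra.
case: b.
  apply: (@le_trans _ _ (p%:E * f true)); first by
    rewrite lee_wpmul2r// lee_fin.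
  by rewrite leeDl// mule_ge0.
apply: (@le_trans _ _ ((1 - p)%:E * f false)); first by
    rewrite lee_wpmul2r// lee_fin.
by rewrite leeDr// mule_ge0.
Qed.

Lemma integral_probability_cst d (T : measurableType d) (R : realType)
    (P : probability T R) (c : \bar R) : \int[P]_x c = c.
Proof.
rewrite integral_cst// [X in _ * X](_ : _ = 1) ?mule1//.
exact: probability_setT.
Qed.

(** * Two dependent coins *)

Section dependent_coins.
Variable R : realType.

Let half : R := (2^-1)%R.
(** The probability that [Y] is [true] given [X = x]; either way [Y] agrees with [X] with
    probability 3/4. *)
Let bias (x : bool) : R := (if x then 3 / 4 else 4^-1)%R.

Let half01 : (0 <= half <= 1)%R.
Proof. by rewrite /half; apply/andP; split; lra. Qed.

Let bias01 x : (0 <= bias x <= 1)%R.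
Proof. by case: x; rewrite /bias; apply/andP; split; lra. Qed.

(* With [Z] trivial, [Pistar] is the product of the laws of [X] and [Y], so any
   dependent pair is a counterexample; this one has full support, which makes
   [Kstar] uniformly minorized. *)
Definition coinX : R.-pker unit ~> bool :=
  @kprobability _ _ unit bool R (fun=> bernoulli_prob half)
    (measurable_cst _).

Let mcoinY : measurable_fun setT
  (fun x : bool => bernoulli_prob (bias x) : pprobability bool R).
Proof. by []. Qed.

Definition coinYX : R.-pker bool ~> bool := kprobability mcoinY.

Let mfst : measurable_fun setT (@fst bool unit).
Proof. exact: measurable_fst. Qed.
HB.instance Definition _ := isMeasurableFun.Build _ _ _ _ (@fst bool unit) mfst.

Definition coinY : R.-pker (bool * unit)%type ~> bool :=
  kpullback coinYX (@fst bool unit).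

Definition coinZ : R.-pker (bool * bool)%type ~> unit :=
  kdirac (measurable_cst tt).

Definition with_unit (xy : bool * bool) : bool * bool * unit := (xy, tt).

Let mwith_unit : measurable_fun setT with_unit.
Proof. exact: measurable_fun_pair. Qed.
HB.instance Definition _ := isMeasurableFun.Build _ _ _ _ with_unit mwith_unit.

Definition coins : probability (bool * bool * unit)%type R :=
  distribution (joint (bernoulli_prob half) coinYX) with_unit.

Let measurable_all (A : set (bool * bool * unit)) : measurable A.
Proof. by apply: measurable_prod_unit => B; exact: measurable_bool_prod. Qed.

Let mfun_all (f : bool * bool * unit -> \bar R) : measurable_fun setT f.
Proof. by move=> _ B mB; exact: measurable_all. Qed.

Lemma integral_coins (f : bool * bool * unit -> \bar R) :
  (forall w, 0 <= f w) ->
  \int[coins]_w f w =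
  \int[bernoulli_prob half]_x \int[bernoulli_prob (bias x)]_y f (x, y, tt).
Proof.
move=> f0; rewrite ge0_integral_distribution// ge0_integral_joint//.
  by move=> _ B mB; apply: measurable_bool_prod.
by move=> xy; exact: f0.
Qed.

(** Indicator factors replace both the event and the restriction to [F], leaving an identity between
    iterated Bernoulli integrals. *)
Lemma conditional_law_coins d1 d2 (A : measurableType d1)
    (B : measurableType d2) (U : {mfun (bool * bool * unit)%type >-> A})
    (V : {mfun (bool * bool * unit)%type >-> B}) (k : R.-pker B ~> A) :
  (forall E F, measurable E -> measurable F ->
    \int[bernoulli_prob half]_x \int[bernoulli_prob (bias x)]_y
      (\1_(U @^-1` E) (x, y, tt) * \1_F (V (x, y, tt)))%:E =
    \int[bernoulli_prob half]_x \int[bernoulli_prob (bias x)]_y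
      (k (V (x, y, tt)) E * (\1_F (V (x, y, tt)))%:E)) ->
  conditional_law coins U V k.
Proof.
move=> UV E F mE mF.
rewrite integral_mkcond ge0_integral_distribution; last 2 first.
- apply/(measurable_restrictT _ mF).
  by apply: measurable_funTS; exact: measurable_kernel.
- by move=> y; apply: erestrict_ge0.
rewrite -[X in coins X]setIT -integral_indic//.
rewrite !integral_coins; last 2 first.
- by move=> w; rewrite lee_fin.
- by move=> w; apply: erestrict_ge0.
rewrite [LHS](_ : _ = \int[bernoulli_prob half]_x
    \int[bernoulli_prob (bias x)]_y
      (\1_(U @^-1` E) (x, y, tt) * \1_F (V (x, y, tt)))%:E); last first.
  by apply: eq_integral => x _; apply: eq_integral => y _; rewrite indicI.
rewrite UV//; apply: eq_integral => x _; apply: eq_integral => y _.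
rewrite /= patchE indicE; case: ifPn => _; first by rewrite mule1.
by rewrite mule0.
Qed.

Lemma coinX_law : conditional_law coins pr_X pr_Z coinX.
Proof.
apply: conditional_law_coins => E F mE mF.
transitivity (\int[bernoulli_prob half]_x ((\1_E x)%:E * (\1_F tt)%:E)).
  apply: eq_integral => x _; rewrite -EFinM.
  exact: (integral_probability_cst (bernoulli_prob (bias x))
    (\1_E x * \1_F tt)%:E).
rewrite ge0_integralZr//.
rewrite integral_indic// setIT.
transitivity (\int[bernoulli_prob half]_x
    (bernoulli_prob half E * (\1_F tt)%:E)).
  by rewrite (integral_probability_cst (bernoulli_prob half)).
apply: eq_integral => x _; apply/esym.
exact: (integral_probability_cst (bernoulli_prob (bias x))
  (bernoulli_prob half E * (\1_F tt)%:E)).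
Qed.

Lemma coinY_law : conditional_law coins pr_Y pr_XZ coinY.
Proof.
apply: conditional_law_coins => E F mE mF; apply: eq_integral => x _.
transitivity (\int[bernoulli_prob (bias x)]_y
    ((\1_E y)%:E * (\1_F (x, tt))%:E)).
  by apply: eq_integral => y _; rewrite -EFinM.
rewrite ge0_integralZr//.
rewrite integral_indic// setIT; apply/esym.
exact: (integral_probability_cst (bernoulli_prob (bias x))
  (bernoulli_prob (bias x) E * (\1_F (x, tt))%:E)).
Qed.

Lemma coinZ_law : conditional_law coins pr_Z pr_XY coinZ.
Proof.
apply: conditional_law_coins => E F mE mF.
by apply: eq_integral => x _; apply: eq_integral => y _; rewrite EFinM.
Qed.

Lemma Kstar_coinsE s A : measurable A ->
  Kstar coinX coinY coinZ s A = \int[bernoulli_prob (bias s.2)]_y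
    bernoulli_prob half (xsection A (y, tt)).
Proof.
move=> mA; rewrite KstarE//; apply: eq_integral => y _.
by rewrite integral_dirac// diracT mul1e.
Qed.

(** From any state, a given [y] is drawn with probability at least 1/4, and then a given [x] with
    probability 1/2. *)
Lemma Kstar_coins_ge s A : measurable A -> A !=set0 ->
  (8^-1)%:E <= Kstar coinX coinY coinZ s A.
Proof.
move=> mA [[[y []] x] Ayx]; rewrite Kstar_coinsE//.
have q0 : (0 <= (4^-1 : R) <= bias s.2)%R.
  by rewrite /bias; case: s.2; apply/andP; split; lra.
have q1 : ((4^-1 : R) <= 1 - bias s.2)%R by rewrite /bias; case: s.2; lra.
apply: (le_trans _ (@ge_integral_bernoulli _ _ _ _ y q0 q1 _)) => //.
have h0 : (0 <= half <= half)%R by rewrite /half; apply/andP; split; lra.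
have h1 : (half <= 1 - half)%R by rewrite /half; lra.
set B := xsection A (y, tt).
have hB : half%:E <= bernoulli_prob half B.
  have ind0 b : 0 <= (\1_B b : R)%:E by rewrite lee_fin.
  have := ge_integral_bernoulli x h0 h1 ind0.
  rewrite integral_indic// setIT indicE mem_set ?mule1//.
  by rewrite /B /xsection /= inE.
apply: (@le_trans _ _ ((4^-1)%:E * half%:E)).
  by rewrite -EFinM lee_fin /half; lra.
by rewrite lee_pmul2l// ?lte_fin.
Qed.

Definition diag : set (bool * unit * bool) := [set s | s.1.1 = s.2].

Lemma target_diag : target coins diag = (3 / 4)%:E.
Proof.
rewrite -[LHS]/(coins (pr_YZX @^-1` diag)) -[X in coins X]setIT.
rewrite -integral_indic// integral_coins//.
have diagE x y : \1_(pr_YZX @^-1` diag) (x, y, tt) = (y == x)%:R :> R.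
  rewrite indicE (_ : (_ \in _) = (y == x))//.
  by apply/idP/eqP; rewrite inE.
under eq_integral do under eq_integral do rewrite diagE.
rewrite integral_bernoulli_prob//; last by move=> x; exact: integral_ge0.
rewrite !integral_bernoulli_prob//; try by move=> y; rewrite lee_fin.
(* The four outcomes of [(X, Y)], of which those with equal coordinates count. *)
transitivity (half * (bias true * 1 + (1 - bias true) * 0) +
  (1 - half) * (bias false * 0 + (1 - bias false) * 1))%:E => //.
by congr (_%:E); rewrite /bias /half; field.
Qed.

(** Under [Pistar] a fair [x] is drawn independently of [y], so it matches any given [y] with
    probability 1/2. *)
Lemma Pistar_diag : Pistar coins coinX diag = (2^-1)%:E.
Proof.
transitivity (\int[distribution coins pr_YZ]_yz (2^-1)%:E); last first.
  by rewrite integral_probability_cst.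
apply: eq_integral => -[y []] _.
rewrite -[LHS]/(bernoulli_prob half (xsection diag (y, tt))).
have diagE b : (b \in xsection diag (y, tt)) = (y == b).
  by rewrite mem_xsection; apply/idP/eqP; rewrite inE.
rewrite [LHS](bernoulli_probE half01) [X in _ * X + _]diracE.
rewrite [X in _ + _ * X]diracE !diagE.
transitivity (half * (y == true)%:R + (1 - half) * (y == false)%:R)%:E => //.
by congr (_%:E); rewrite /half; case: y {diagE} => /=; field.
Qed.

End dependent_coins.

(** By uniqueness an invariant target would equal [Pistar], but they give [diag] the masses 3/4 and
    1/2. *)
Lemma coins_not_invariant (R : realType) :
  irreducible (Kstar (coinX R) (coinY R) (coinZ R)) ->
  ~ invariant_probability (Kstar (coinX R) (coinY R) (coinZ R))
      (target (coins R)).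
Proof.
move=> irr inv.
have inv' := Pistar_invariant (@coinX_law R) (@coinY_law R) (@coinZ_law R).
have mdiag : measurable diag.
  have mf : measurable_fun setT (fun s : bool * unit * bool => (s.1.1, s.2)).
    apply: measurable_fun_pair => //.
    exact: measurableT_comp measurable_fst measurable_fst.
  rewrite -[diag]setTI; apply: (mf _ [set ab | ab.1 = ab.2]) => //.
  exact: measurable_bool_prod.
have := irreducible_invariant_unique irr inv inv' mdiag.
rewrite target_diag Pistar_diag => -[]; lra.
Qed.

Lemma unit_countably_generated : countably_generated unit.
Proof.
by apply: (@countably_generated_countType _ _ (fun=> 0%N)) => // -[] [].
Qed.

Lemma bool_countably_generated : countably_generated bool.
Proof.
by apply: (@countably_generated_countType _ _ nat_of_bool) => // -[] [].
Qed.

(** The target equals [Pistar] when [X] and [Y] are conditionally independent given [Z]. Its failure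
    to be invariant is therefore asserted whenever the two differ, together with an instance where
    it occurs. *)
Theorem mainTheorem1 (R : realType) :
  (forall (dX dY dZ : measure_display) (X : measurableType dX)
      (Y : measurableType dY) (Z : measurableType dZ)
      (Pi : probability (X * Y * Z)%type R)
      (kX : R.-pker Z ~> X) (kY : R.-pker (X * Z) ~> Y)
      (kZ : R.-pker (X * Y) ~> Z),
    countably_generated X -> countably_generated Y -> countably_generated Z ->
    conditional_law Pi pr_X pr_Z kX ->
    conditional_law Pi pr_Y pr_XZ kY ->
    conditional_law Pi pr_Z pr_XY kZ ->
    irreducible (Kstar kX kY kZ) ->
    aperiodic (Kstar kX kY kZ) ->
    positive_harris_recurrent (Kstar kX kY kZ) ->
    [/\ (forall E, measurable E ->
          \int[Pistar Pi kX]_s Kstar kX kY kZ s E = Pistar Pi kX E),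
        (forall mu : probability (Y * Z * X)%type R,
          invariant_probability (Kstar kX kY kZ) mu ->
          forall E, measurable E -> mu E = Pistar Pi kX E) &
        ((exists2 E, measurable E & target Pi E <> Pistar Pi kX E) ->
          ~ invariant_probability (Kstar kX kY kZ) (target Pi))])
  /\
  (exists (dX dY dZ : measure_display) (X : measurableType dX)
      (Y : measurableType dY) (Z : measurableType dZ)
      (Pi : probability (X * Y * Z)%type R)
      (kX : R.-pker Z ~> X) (kY : R.-pker (X * Z) ~> Y)
      (kZ : R.-pker (X * Y) ~> Z),
    [/\ [/\ countably_generated X, countably_generated Y &
          countably_generated Z],
        [/\ conditional_law Pi pr_X pr_Z kX,
            conditional_law Pi pr_Y pr_XZ kY &
            conditional_law Pi pr_Z pr_XY kZ],
        [/\ irreducible (Kstar kX kY kZ),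
            aperiodic (Kstar kX kY kZ) &
            positive_harris_recurrent (Kstar kX kY kZ)] &
        ~ invariant_probability (Kstar kX kY kZ) (target Pi)]).
Proof.
split=> [dX dY dZ X Y Z Pi kX kY kZ _ _ _ kXP kYP kZP irr _ _|].
  have inv := Pistar_invariant kXP kYP kZP.
  split=> [//|mu mui E mE|[E mE neq] /irreducible_invariant_unique target_eq].
    exact: irreducible_invariant_unique irr mui inv E mE.
  exact/neq/target_eq.
have K8 := @Kstar_coins_ge R.
have e0 : (0 < 8^-1 :> R)%R by [].
exists _, _, _, bool, bool, unit, (coins R), (coinX R), (coinY R), (coinZ R).
(* The base point is arbitrary; it only carries the Dirac irreducibility measure. *)
have irr := doeblin_irreducible e0 K8 (true, tt, true).
split.
- by split; [exact: bool_countably_generated|exact: bool_countably_generated|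
             exact: unit_countably_generated].
- by split; [exact: coinX_law|exact: coinY_law|exact: coinZ_law].
- split=> //; first exact: doeblin_aperiodic e0 K8.
  split; first exact: doeblin_harris e0 K8 (true, tt, true).
  exists (Pistar (coins R) (coinX R)).
  apply: Pistar_invariant; [exact: coinX_law|exact: coinY_law|exact: coinZ_law].
- exact: coins_not_invariant.
Qed.
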